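(* Consider the multinomial logistic model described in the context with $m$ distinct experimental settings $\mathbf x_i$ and $n_i>0$ experimental units, $i=1,\dots,m$. The Fisher information matrix $\mathbf F$ is positive definite if and only if both of the following hold: (1) $m\ge\max\{p_1,\dots,p_{J-1},p_c+p_H\}$, where $p_H=\dim\big(\bigcap_{j=1}^{J-1}\mathcal M(\mathbf H_j^T)\big)$; and (2) the $\mathbf x_i$'s keep $\mathbf H_j$ of full row rank $p_j$ for $j=1,\dots,J-1$, keep $\mathbf H_c$ of full row rank $p_c$, and $\mathcal M(\mathbf H_c^T)\cap\big(\bigcap_{j=1}^{J-1}\mathcal M(\mathbf H_j^T)\big)=\{0\}$. As a special case, if $\mathbf H_1=\cdots=\mathbf H_{J-1}$, then $\mathbf F$ is positive definite if and only if $m\ge p_c+p_1$ and the extended matrix $(\mathbf H_1^T,\mathbf H_c^T)$ is of full rank $p_c+p_1$.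
   Context: Let $d\ge 1$, $m\ge 2$, $J\ge 2$ be integers and $\mathbf x_1,\dots,\mathbf x_m\in\mathbb R^d$ distinct experimental settings. For each $i$ one observes $\mathbf Y_i=(Y_{i1},\dots,Y_{iJ})^T\sim{\rm Multinomial}(n_i;\pi_{i1},\dots,\pi_{iJ})$, independently over $i$, where $\sum_j\pi_{ij}=1$. Model. Known functions $\mathbf h_j$ with values in $\mathbb R^{p_j}$ ($j=1,\dots,J-1$) and $\mathbf h_c$ with values in $\mathbb R^{p_c}$ are given; the parameter is $\boldsymbol\theta=(\boldsymbol\beta_1^T,\dots,\boldsymbol\beta_{J-1}^T,\boldsymbol\zeta^T)^T\in\mathbb R^p$ with $\boldsymbol\beta_j\in\mathbb R^{p_j}$, $\boldsymbol\zeta\in\mathbb R^{p_c}$, $p=p_1+\dots+p_{J-1}+p_c$. ($p_c=0$, i.e. no $\mathbf h_c,\boldsymbol\zeta$, is allowed.) For one fixed choice among four logit types, $\log(\nu_{ij}/\delta_{ij})=\mathbf h_j^T(\mathbf x_i)\boldsymbol\beta_j+\mathbf h_c^T(\mathbf x_i)\boldsymbol\zeta$ for $j=1,\dots,J-1$, where $(\nu_{ij},\delta_{ij})$ is: $(\pi_{ij},\pi_{iJ})$ (baseline-category); $(\pi_{i1}+\dots+\pi_{ij},\ \pi_{i,j+1}+\dots+\pi_{iJ})$ (cumulative); $(\pi_{ij},\pi_{i,j+1})$ (adjacent-categories); $(\pi_{ij},\ \pi_{i,j+1}+\dots+\pi_{iJ})$ (continuation-ratio). It is assumed that $\pi_{ij}>0$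 for all $i,j$. The Fisher information matrix $\mathbf F$ ($p\times p$) is the covariance matrix of the score vector $\partial l/\partial\boldsymbol\theta$, where $l$ is the log-likelihood of $(\mathbf Y_i)_i$. $\mathbf H_j=(\mathbf h_j(\mathbf x_1),\dots,\mathbf h_j(\mathbf x_m))$ is $p_j\times m$ and $\mathbf H_c=(\mathbf h_c(\mathbf x_1),\dots,\mathbf h_c(\mathbf x_m))$ is $p_c\times m$. $\mathcal M(\mathbf A)$ denotes the column space of a matrix $\mathbf A$. *)

(* Defs.v *)
From HB Require Import structures.
From mathcomp Require Export all_boot all_order all_algebra.
From mathcomp Require Export all_classical all_reals all_analysis.
Export Order.TTheory GRing.Theory Num.Theory.
Export numFieldNormedType.Exports.

Set Implicit Arguments.
Unset Strict Implicit.
Unset Printing Implicit Defensive.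

Local Open Scope classical_set_scope.
Local Open Scope ring_scope.

Inductive logit_type :=
  Baseline | Cumulative | Adjacent | ContinuationRatio.

(* nu_j and delta_j are the total probabilities of two sets of categories.
   Indices are 0-based: the categories are 0, ..., J-1, so the last one is
   J.-1, and the logits are 0, ..., J-2. *)
Definition logit_num (lt : logit_type) (J : nat) (j : 'I_J.-1) : {set 'I_J} :=
  match lt with
  | Baseline | Adjacent | ContinuationRatio => [set k : 'I_J | k == j :> nat]
  | Cumulative => [set k : 'I_J | (k <= j)%N]
  end%SET.

Definition logit_den (lt : logit_type) (J : nat) (j : 'I_J.-1) : {set 'I_J} :=
  match lt with
  | Baseline => [set k : 'I_J | k == J.-1 :> nat]
  | Adjacent => [set k : 'I_J | k == j.+1 :> nat]
  | Cumulative | ContinuationRatio => [set k : 'I_J | (j < k)%N]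
  end%SET.

Section Model.
Variables (R : realType) (d m J pc : nat) (p : 'I_J.-1 -> nat).
Variables (lt : logit_type) (x : 'I_m -> 'cV[R]_d).
Variables (h : forall j : 'I_J.-1, 'cV[R]_d -> 'cV[R]_(p j)).
Variable hc : 'cV[R]_d -> 'cV[R]_pc.

(* theta is the stacked column (beta_1; ...; beta_{J-1}; zeta). *)
Definition beta (theta : 'cV[R]_(\sum_j p j + pc)) (j : 'I_J.-1) :
  'cV[R]_(p j) := submxcol (usubmx theta) j.

Definition zeta (theta : 'cV[R]_(\sum_j p j + pc)) : 'cV[R]_pc :=
  dsubmx theta.

Definition mlogit_model (theta : 'cV[R]_(\sum_j p j + pc))
    (q : 'I_m -> 'I_J -> R) : Prop :=
  [/\ forall i k, 0 < q i k,
      forall i, \sum_k q i k = 1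
    & forall i j,
        ln ((\sum_(k in logit_num lt j) q i k) /
            (\sum_(k in logit_den lt j) q i k)) =
        ((h j (x i))^T *m beta theta j) 0 0 + ((hc (x i))^T *m zeta theta) 0 0].

(* For the cumulative logit this is a proper subset of the parameter space
   when J > 2, since the logits have to increase strictly with j. *)
Definition mlogit_dom : set 'cV[R]_(\sum_j p j + pc) :=
  [set theta | exists q, mlogit_model theta q].

Definition Hmx (j : 'I_J.-1) : 'M[R]_(p j, m) :=
  \matrix_(k, i) h j (x i) k 0.

Definition Hcmx : 'M[R]_(pc, m) := \matrix_(k, i) hc (x i) k 0.

End Model.

Section Multinomial.
Variables (R : realType) (J : nat).

Definition multinomial_pmf (n : nat) (q : 'I_J -> R) (y : 'I_J -> nat) : R :=
  if (\sum_k y k == n)%N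
  then n`!%:R / (\prod_k (y k)`!%:R) * \prod_k q k ^+ y k
  else 0.

Definition multinomial_law d (T : measurableType d) (P : probability T R)
    (X : T -> 'I_J -> nat) (n : nat) (q : 'I_J -> R) : Prop :=
  forall y, P (X @^-1` [set y]) = (multinomial_pmf n q y)%:E.

(* Mutual independence of count vectors. Every subset of 'I_J -> nat (a
   countable set) is an event; subfamilies are covered by A i = setT. *)
Definition independent_counts d (T : measurableType d) (P : probability T R)
    (m : nat) (X : 'I_m -> T -> 'I_J -> nat) : Prop :=
  forall A : 'I_m -> set ('I_J -> nat),
    P (\bigcap_(i in [set: 'I_m]) (X i @^-1` A i)) =
    (\prod_(i < m) P (X i @^-1` A i))%E.

End Multinomial.

Section Fisher.
Variables (R : realType) (m J r : nat) (n : 'I_m -> nat).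
Variable q : 'cV[R]_r -> 'I_m -> 'I_J -> R.

Definition loglik (y : 'I_m -> 'I_J -> nat) (theta : 'cV[R]_r) : R :=
  ln (\prod_i multinomial_pmf (n i) (q theta i) (y i)).

Definition score (theta : 'cV[R]_r) (y : 'I_m -> 'I_J -> nat) : 'cV[R]_r :=
  \col_a 'D_(delta_mx a 0) (loglik y) theta.

Definition fisher d (T : measurableType d) (P : probability T R)
    (Y : 'I_m -> T -> 'I_J -> nat) (theta : 'cV[R]_r) : 'M[R]_r :=
  \matrix_(a, b) fine (covariance P
    (fun w => score theta (fun i => Y i w) a 0)
    (fun w => score theta (fun i => Y i w) b 0)).

End Fisher.

Definition posdefmx (R : realType) (r : nat) (A : 'M[R]_r) : Prop :=
  A \is symmetricmx /\
  forall v : 'cV[R]_r, v != 0 -> 0 < (v^T *m A *m v) 0 0.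

(* mathcomp's matrix spaces are row spaces, hence the transpose. *)
Definition colspace (R : realType) (a b : nat) (A : 'M[R]_(a, b)) : 'M[R]_a :=
  <<A^T>>%MS.

(* Main.v *)
Require Import Defs.
From mathcomp Require Import zify ring.

(** Every logit type says num_j(q) = exp(eta_j) den_j(q) for sums num_j, den_j of
    category probabilities, a linear system in q which, together with
    sum_k q_k = 1, is invertible whatever the positive factors exp(eta_j). Hence q
    is a smooth function of the linear predictors eta (Cramer's rule), and the
    same system, applied to the directional derivatives of q, shows that they all
    vanish in a direction v iff all eta_ij(v) vanish.
    F is the covariance matrix of the score, so v^T F v = 0 iff the score in the
    direction v is almost surely constant; comparing outcomes in which each
    setting puts all its observations in a single category, this happens iff the
    derivatives of q along v vanish. So F is positive definite iff
    H_j^T beta_j + H_c^T zeta = 0 for all j forces all beta_j and zeta to be 0,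
    which is the rank condition of the theorem. *)

Set Implicit Arguments.
Unset Strict Implicit.
Unset Printing Implicit Defensive.

Local Open Scope classical_set_scope.
Local Open Scope ring_scope.

(** * The logit equations as a linear system *)

Section LogitSystem.
Variables (R : realFieldType) (lt : logit_type) (n : nat) (c : 'I_n -> R).

(** The total is a positive multiple of the last entry, so that entry vanishes and all others with
    it. Serves the logit types that compare single categories. *)
Lemma positive_multiples_eq0 (u : 'I_n.+1 -> R) :
  (forall k, exists2 C, 0 < C & u k = C * u ord_max) ->
  \sum_k u k = 0 -> forall k, u k = 0.
Proof.
move=> uC su0.
have C_ex k : exists C, 0 < C /\ u k = C * u ord_max.
  by have [C C0 uE] := uC k; exists C.
have [C /all_and2[C_gt0 uE]] := choice C_ex.
suff um0 : u ord_max = 0 by move=> k; rewrite uE um0 mulr0.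
have : (\sum_k C k) * u ord_max = 0.
  by rewrite mulr_suml -[RHS]su0; apply: eq_bigr => k _; rewrite -uE.
move/eqP; rewrite mulf_eq0 => /orP[|/eqP//].
by rewrite gt_eqF // (bigD1 ord0) //= ltr_pwDl // sumr_ge0 // => k _;
  exact: ltW.
Qed.

(** Consecutive tail sums differ by one entry; [k] ranges over all naturals so that the empty tail
    after the last entry is included. *)
Lemma tail_sums_eq0 (u : 'I_n.+1 -> R) :
  (forall k, \sum_(i < n.+1 | (k <= i)%N) u i = 0) -> forall k, u k = 0.
Proof.
move=> tail0 k; have := tail0 k; rewrite (bigD1 k) //=.
rewrite (eq_bigl (fun i : 'I_n.+1 => (k.+1 <= i)%N)) ?tail0 ?addr0 // => i.
by rewrite ltn_neqAle andbC eq_sym.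
Qed.

Hypothesis c_gt0 : forall j, 0 < c j.

(** Baseline and adjacent logits make every entry a positive multiple of the last one; cumulative
    and continuation-ratio logits make every tail sum vanish, because [1 + c j] is nonzero. *)
Lemma logit_system_inj (u : 'I_n.+1 -> R) :
  (forall j : 'I_n, \sum_(k in logit_num lt (J := n.+1) j) u k =
                    c j * \sum_(k in logit_den lt (J := n.+1) j) u k) ->
  \sum_k u k = 0 -> forall k, u k = 0.
Proof.
have point (a : nat) (an : (a < n.+1)%N) :
    \sum_(k in [set k : 'I_n.+1 | k == a :> nat]%SET) u k = u (Ordinal an).
  by rewrite (big_pred1 (Ordinal an)) // => k; rewrite inE.
have tailS (j : 'I_n) : \sum_(i < n.+1 | (j <= i)%N) u i =
    u (widen_ord (leqnSn n) j) + \sum_(i < n.+1 | (j < i)%N) u i.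
  rewrite (bigD1 (widen_ord (leqnSn n) j)) //=; congr (_ + _).
  by apply: eq_bigl => i; rewrite ltn_neqAle andbC eq_sym.
have tail_out k : (n < k)%N -> \sum_(i < n.+1 | (k <= i)%N) u i = 0.
  by move=> nk; rewrite big_pred0 // => i; apply/negbTE; rewrite -ltnNge;
    apply: leq_trans nk.
move=> uE su0; case: lt uE; rewrite /logit_num /logit_den => uE.
- apply: positive_multiples_eq0 su0 => k.
  case: (unliftP ord_max k) => [j ->|->]; last by exists 1; rewrite ?mul1r.
  exists (c j) => //; have := uE j.
  rewrite (point j (leqW (ltn_ord j))) (point n (ltnSn n)).
  move=> H; rewrite -[ord_max]/(Ordinal (ltnSn n)) in H *.
  by rewrite [RHS](_ : _ = c j * u (Ordinal (ltnSn n))) -?H; congr (u _);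
    apply/val_inj => //=; rewrite /bump leqNgt ltn_ord.
(* Cumulative: the sum [a] up to [k] and the sum [b] beyond [k] satisfy [a + b = 0] and
   [a = d * b]. *)
- apply: tail_sums_eq0 => -[|k].
    by rewrite -[RHS]su0; exact: eq_bigl.
  have [nk|kn] := leqP n k; first exact: tail_out.
  have := uE (Ordinal kn); rewrite !big_set /=.
  move: su0; rewrite (bigID (fun i : 'I_n.+1 => (i <= k)%N)) /=.
  under [X in _ + X]eq_bigl do rewrite -ltnNge.
  have := c_gt0 (Ordinal kn); set a := \sum_(i < _ | _) _.
  set b := \sum_(i < _ | _) _; set d := c _ => d0 ab ad.
  have /eqP : (1 + d) * b = 0 by rewrite mulrDl mul1r -ad addrC.
  by rewrite mulf_eq0 => /orP[|/eqP//]; rewrite gt_eqF ?addr_gt0.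
- apply: positive_multiples_eq0 su0 => k.
  (* Adjacent: induction on the distance to the last category, collecting one factor [c j] per
     step. *)
  have [i] := ubnP (n - k); elim: i k => // i IH k ki.
  case: (unliftP ord_max k) => [j kj|->]; last by exists 1; rewrite ?mul1r.
  have := uE j; rewrite (point j (leqW (ltn_ord j))) (point j.+1 (ltn_ord j)).
  have jk : nat_of_ord k = j by rewrite kj /= /bump leqNgt ltn_ord.
  have [|C C0 ->] := IH (Ordinal (ltn_ord j : (j.+1 < n.+1)%N)).
    by apply: (@leq_trans (n - k)) => //=; rewrite jk ltn_sub2l.
  move=> ujE; exists (c j * C); first exact: mulr_gt0.
  by rewrite -mulrA -ujE; congr (u _); apply/val_inj.
(* Continuation-ratio: the tail from [k] is [c k + 1] times the tail from [k.+1], so vanishing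
   propagates upwards. *)
- apply: tail_sums_eq0; elim=> [|k IH].
    by rewrite -[RHS]su0; exact: eq_bigl.
  have [nk|kn] := leqP n k; first exact: tail_out.
  have := tailS (Ordinal kn); rewrite /= IH => /esym.
  have := uE (Ordinal kn); rewrite (point k (leqW kn)) big_set /=.
  rewrite (_ : widen_ord _ _ = Ordinal (leqW kn)); last exact/val_inj.
  move=> ->; rewrite -[X in _ + X]mul1r -mulrDl => /eqP.
  rewrite mulf_eq0 => /orP[|/eqP//].
  by rewrite gt_eqF // addr_gt0.
Qed.

(* The logit equations num_j(q) = c_j den_j(q) are linear in q; row 0 is the
   constraint that q has total mass 1. *)
Definition logit_mx : 'M[R]_n.+1 :=
  \matrix_(i, k) if unlift ord0 i is Some j
    then (k \in logit_num lt (J := n.+1) j)%:R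
         - c j * (k \in logit_den lt (J := n.+1) j)%:R
    else 1.

Lemma logit_mx_mul0 (u : 'cV_n.+1) : (logit_mx *m u) ord0 0 = \sum_k u k 0.
Proof.
by rewrite mxE; apply: eq_bigr => k _; rewrite mxE unlift_none mul1r.
Qed.

Lemma logit_mx_mulS (u : 'cV_n.+1) (j : 'I_n) :
  (logit_mx *m u) (lift ord0 j) 0 =
  \sum_(k in logit_num lt (J := n.+1) j) u k 0
  - c j * \sum_(k in logit_den lt (J := n.+1) j) u k 0.
Proof.
rewrite mxE [in RHS]big_mkcond [X in _ * X]big_mkcond mulr_sumr -sumrB.
apply: eq_bigr => k _; rewrite mxE liftK.
by rewrite mulrBl -mulrA !mulr_natl !mulrb.
Qed.

(** The total [b] is 1 for category probabilities and 0 for elements of the kernel. *)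
Lemma logit_mx_eqP (u : 'cV[R]_n.+1) (b : R) :
  logit_mx *m u = b *: delta_mx 0 0 <->
  \sum_k u k 0 = b /\
  (forall j : 'I_n, \sum_(k in logit_num lt (J := n.+1) j) u k 0 =
                    c j * \sum_(k in logit_den lt (J := n.+1) j) u k 0).
Proof.
split=> [Au|[u0 uS]].
  split; first by rewrite -logit_mx_mul0 Au !mxE mulr1.
  move=> j; apply/eqP; rewrite -subr_eq0 -logit_mx_mulS Au !mxE /= mulr0.
  by [].
apply/colP => i; case: (unliftP 0 i) => [j ->|->].
  by rewrite logit_mx_mulS uS subrr !mxE mulr0.
by rewrite logit_mx_mul0 u0 !mxE mulr1.
Qed.

Lemma logit_mx_unit : logit_mx \in unitmx.
Proof.
rewrite -unitmx_tr -row_free_unit; apply: inj_row_free => v vA.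
have /logit_mx_eqP[s0 sS] : logit_mx *m v^T = 0 *: delta_mx 0 0.
  by rewrite scale0r -[LHS]trmxK trmx_mul trmxK vA trmx0.
by apply/rowP => k; have := logit_system_inj sS s0 k; rewrite !mxE.
Qed.

End LogitSystem.

(** * Derivatives of the category probabilities along lines *)

Lemma derive_lineE (R : numFieldType) (V W : normedModType R) (f : V -> W) a v :
  'D_v f a = 'D_1 (fun s : R => f (s *: v + a)) 0.
Proof.
rewrite /derive; set g1 := fun h => h^-1 *: _; set g2 := fun h => h^-1 *: _.
suff -> : g1 = g2 by [].
by apply/funext => s; rewrite /g1 /g2 /= addr0 scale0r add0r [_%:A]mulr1.
Qed.

(** * Differentiability of sums, products, determinants and inverses along a curve of matrices *)

Section MatrixCurve.
Variable R : realType.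
Implicit Types t : R.

Lemma is_derive_big_sum (I : Type) (r : seq I) (f : I -> R -> R)
    (df : I -> R) t v :
  (forall i, is_derive t v (f i) (df i)) ->
  is_derive t v (fun s => \sum_(i <- r) f i s) (\sum_(i <- r) df i).
Proof.
move=> fdf; elim: r => [|i r IH].
  rewrite big_nil [X in is_derive _ _ X _](_ : _ = cst 0).
    exact: is_derive_cst.
  by apply/funext => s; rewrite big_nil.
rewrite big_cons [X in is_derive _ _ X _](_ : _ =
  f i + (fun s => \sum_(i <- r) f i s)); first exact: is_deriveD.
by apply/funext => s; rewrite big_cons.
Qed.

Lemma derivable_big_sum (I : Type) (r : seq I) (f : I -> R -> R) t v :
  (forall i, derivable (f i) t v) ->
  derivable (fun s => \sum_(i <- r) f i s) t v.
Proof. by move=> fd; apply: ex_derive; apply: is_derive_big_sum. Qed.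

Lemma derivable_big_prod (I : Type) (r : seq I) (f : I -> R -> R) t v :
  (forall i, derivable (f i) t v) ->
  derivable (fun s => \prod_(i <- r) f i s) t v.
Proof.
move=> fd; elim: r => [|i r IH].
  rewrite [X in derivable X](_ : _ = cst 1); first exact: derivable_cst.
  by apply/funext => s; rewrite big_nil.
rewrite [X in derivable X](_ : _ = f i * (fun s => \prod_(i <- r) f i s)).
  exact: derivableM.
by apply/funext => s; rewrite big_cons.
Qed.

Lemma derivable_det n (A : R -> 'M[R]_n) t v :
  (forall i j, derivable (fun s => A s i j) t v) ->
  derivable (fun s => \det (A s)) t v.
Proof.
move=> Ad; apply: derivable_big_sum => s; apply: derivableM.
  exact: derivable_cst.
by apply: derivable_big_prod => i; exact: Ad.
Qed.

Lemma derivable_invmx n (A : R -> 'M[R]_n) t v i j :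
  (forall s, A s \in unitmx) ->
  (forall i j, derivable (fun s => A s i j) t v) ->
  derivable (fun s => invmx (A s) i j) t v.
Proof.
move=> Au Ad.
rewrite [X in derivable X](_ : _ =
  (fun s => (\det (A s))^-1) * (fun s => \adj (A s) i j)); last first.
  by apply/funext => s; rewrite /invmx Au mxE.
apply: derivableM.
  apply: derivableV; last exact: derivable_det.
  by have := Au t; rewrite unitmxE unitfE.
rewrite [X in derivable X](_ : _ =
   fun s => (-1) ^+ (j + i) * \det (row' j (col' i (A s)))); last first.
  by apply/funext => s; rewrite mxE.
apply: derivableM; first exact: derivable_cst.
apply: derivable_det => a b.
rewrite [X in derivable X](_ : _ = fun s => A s (lift j a) (lift i b)) //.
by apply/funext => s; rewrite !mxE.
Qed.

End MatrixCurve.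

Lemma ln_ratioE (R : realType) (a b e : R) : 0 < a -> 0 < b ->
  ln (a / b) = e <-> a = expR e * b.
Proof.
move=> a0 b0; split=> [<-|->].
  by rewrite lnK ?posrE ?divr_gt0 // divfK // gt_eqF.
by rewrite mulfK ?gt_eqF // expRK.
Qed.

(** Ensures that both sums in a logit are positive, so that logarithms can be removed. Category [j]
    is always in the numerator; the denominator contains [j.+1] for adjacent logits and the last
    category otherwise. *)
Lemma logit_num_den_neq0 lt n (j : 'I_n) :
  (exists k, k \in logit_num lt (J := n.+1) j) /\
  (exists k, k \in logit_den lt (J := n.+1) j).
Proof.
by split; [exists (widen_ord (leqnSn n) j)
          |exists (if lt is Adjacent then lift ord0 j else ord_max)];
   case: lt; rewrite !inE //= ?leqnn ?ltn_ord.
Qed.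

(** * The category probabilities on the line [s *: v + th] *)

Section Curve.
Variables (R : realType) (d m n pc : nat) (p : 'I_n -> nat).
Variables (lt : logit_type) (x : 'I_m -> 'cV[R]_d).
Variables (h : forall j : 'I_n, 'cV[R]_d -> 'cV[R]_(p j)).
Variable hc : 'cV[R]_d -> 'cV[R]_pc.

Definition predictor (i : 'I_m) (j : 'I_n) (th : 'cV[R]_(\sum_j p j + pc)) : R :=
  ((h j (x i))^T *m beta (J := n.+1) th j) 0 0
  + ((hc (x i))^T *m zeta (J := n.+1) th) 0 0.

Lemma predictorP i j t v th :
  predictor i j (t *: v + th) = t * predictor i j v + predictor i j th.
Proof.
rewrite /predictor.
have -> : beta (J := n.+1) (t *: v + th) j =
    t *: beta (J := n.+1) v j + beta (J := n.+1) th j.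
  by apply/colP => k; rewrite !mxE.
have -> : zeta (J := n.+1) (t *: v + th) =
    t *: zeta (J := n.+1) v + zeta (J := n.+1) th.
  by apply/colP => k; rewrite !mxE.
by rewrite !mulmxDr -!scalemxAr !mxE mulrDr; ring.
Qed.

Let cf i th (j : 'I_n) : R := expR (predictor i j th).

(** Exponentiating the logits gives the linear system. Positivity stays a separate clause, since the
    solution for cumulative logits can have nonpositive entries. *)
Lemma mlogit_modelP th (q : 'I_m -> 'I_n.+1 -> R) :
  mlogit_model (J := n.+1) lt x h hc th q <->
  (forall i k, 0 < q i k) /\
  (forall i, logit_mx lt (cf i th) *m (\col_k q i k) = 1 *: delta_mx 0 0).
Proof.
have sumE i (B : {set 'I_n.+1}) :
  \sum_(k in B) (\col_k q i k) k 0 = \sum_(k in B) q i k.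
  by apply: eq_bigr => k _; rewrite mxE.
have sum_gt0 (f : 'I_n.+1 -> R) (B : {set 'I_n.+1}) :
  (forall k, 0 < f k) -> (exists k, k \in B) -> 0 < \sum_(k in B) f k.
  move=> f0 [k kB]; rewrite (bigD1 k) //= ltr_pwDl // sumr_ge0 // => l _.
  exact: ltW.
split=> [[q0 q1 qe]|[q0 qA]].
  split=> // i; apply/logit_mx_eqP; split=> [|j].
    by rewrite -[RHS](q1 i); apply: eq_bigr => k _; rewrite mxE.
  have [nB dB] := logit_num_den_neq0 lt j.
  by rewrite !sumE; apply/ln_ratioE; rewrite ?sum_gt0 //; exact: qe.
split=> // i.
  have /logit_mx_eqP[<- _] := qA i.
  by apply: eq_bigr => k _; rewrite mxE.
move=> j; have [nB dB] := logit_num_den_neq0 lt j.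
apply/ln_ratioE; rewrite ?sum_gt0 //.
by have /logit_mx_eqP[_ /(_ j)] := qA i; rewrite !sumE.
Qed.

Variables (q : 'cV[R]_(\sum_j p j + pc) -> 'I_m -> 'I_n.+1 -> R).
Hypothesis q_model : forall t, mlogit_dom (J := n.+1) lt x h hc t ->
  mlogit_model (J := n.+1) lt x h hc t (q t).
Variables (th v : 'cV[R]_(\sum_j p j + pc)).
Hypothesis th_dom : mlogit_dom (J := n.+1) lt x h hc th.

(** Defined for every [s], also where the line has left the parameter domain and [q] is
    unconstrained. *)
Let sol i s : 'cV[R]_n.+1 :=
  invmx (logit_mx lt (cf i (s *: v + th))) *m (1 *: delta_mx 0 0).

Let cf_gt0 i s j : 0 < cf i s j. Proof. exact: expR_gt0. Qed.

Let solP i s (u : 'cV[R]_n.+1) :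
  logit_mx lt (cf i (s *: v + th)) *m u = 1 *: delta_mx 0 0 <-> u = sol i s.
Proof.
have Au := logit_mx_unit lt (cf_gt0 i (s *: v + th)).
rewrite /sol; split=> [<-|->]; first by rewrite mulKmx.
by rewrite mulKVmx.
Qed.

Let cf_derive i j :
  is_derive (0 : R) 1 (fun s => cf i (s *: v + th) j)
    (predictor i j v * cf i th j).
Proof.
have lin : is_derive (0 : R) 1
    (fun s => s * predictor i j v + predictor i j th) (predictor i j v).
  apply: is_derive_eq.
  by rewrite /= !scaler0 ?addr0 ?add0r /GRing.scale /= ?mulr1.
have -> : (fun s => cf i (s *: v + th) j) =
    expR \o (fun s => s * predictor i j v + predictor i j th).
  by apply/funext => s; rewrite /cf predictorP.
have := is_derive1_comp (is_derive_expR _) lin.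
by rewrite mul0r add0r mulrC.
Qed.

Let sol_derivable i k : derivable (fun s => sol i s k 0) 0 1.
Proof.
rewrite [X in derivable X](_ : _ =
    fun s => \sum_l invmx (logit_mx lt (cf i (s *: v + th))) k l *
       (1 *: (delta_mx 0 0 : 'cV[R]_n.+1)) l 0); last first.
  by apply/funext => s; rewrite /sol mxE.
apply: derivable_big_sum => l; apply: derivableM; last exact: derivable_cst.
apply: derivable_invmx => [s|a b]; first exact: logit_mx_unit.
rewrite [X in derivable X](_ : _ = fun s => if unlift ord0 a is Some j
    then (b \in logit_num lt (J := n.+1) j)%:R
         - cf i (s *: v + th) j * (b \in logit_den lt (J := n.+1) j)%:R
    else 1); last by apply/funext => s; rewrite mxE.
case: (unlift ord0 a) => [j|]; last exact: derivable_cst.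
apply: derivableB; first exact: derivable_cst.
by apply: derivableM; [apply: ex_derive | exact: derivable_cst].
Qed.

Let q_sol0 i k : q th i k = sol i 0 k 0.
Proof.
have /mlogit_modelP[_ /(_ i) qA] := q_model th_dom.
rewrite (_ : sol i 0 = \col_k q th i k) ?mxE //.
by apply/esym/solP; rewrite scale0r add0r.
Qed.

(* The solution of the logit equations at [th] is positive, hence stays so
   nearby, and a positive solution is a model: this gives both that the domain
   is open along the line and that [q] is the solution there. *)
Let q_sol : \forall s \near (0 : R), forall i k,
  0 < q (s *: v + th) i k /\ q (s *: v + th) i k = sol i s k 0.
Proof.
have sol_gt0 : \forall s \near (0 : R), forall i k, 0 < sol i s k 0.
  have cont i k : \forall s \near (0 : R), 0 < sol i s k 0.
    have /derivable1_diffP/differentiable_continuous sc := @sol_derivable i k.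
    have : 0 < sol i 0 k 0.
      have /mlogit_modelP[q0 _] := q_model th_dom.
      by rewrite -q_sol0.
    by apply: (@cvgr_gt _ _ (nbhs (0 : R)) _ (fun s => sol i s k 0)); exact: sc.
  apply: (@filter_forall _ _ (fun i s => forall k, 0 < sol i s k 0)
    (nbhs (0 : R)) _) => i.
  by apply: (@filter_forall _ _ (fun k s => 0 < sol i s k 0) (nbhs (0 : R)) _)
    => k; exact: cont.
near=> s.
have s_gt0 : forall i k, 0 < sol i s k 0 by near: s.
have sdom : mlogit_dom (J := n.+1) lt x h hc (s *: v + th).
  exists (fun i k => sol i s k 0); apply/mlogit_modelP; split=> // i.
  by apply/solP/colP => k; rewrite mxE.
have /mlogit_modelP[_ qA] := q_model sdom.
move=> i k; suff -> : q (s *: v + th) i k = sol i s k 0 by [].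
by have /solP <- := qA i; rewrite mxE.
Unshelve. all: by end_near. Qed.

Lemma mlogit_line_gt0 : \forall s \near (0 : R), forall i k,
  0 < q (s *: v + th) i k.
Proof. by apply: filterS q_sol => s qs i k; have [] := qs i k. Qed.

Let q_line_derive i k : is_derive (0 : R) 1 (fun s : R => q (s *: v + th) i k)
  ('D_1 (fun s : R => sol i s k 0) 0).
Proof.
apply: (@near_eq_is_derive _ _ _ (fun s : R => sol i s k 0));
  last exact: derivableP.
by apply: filterS q_sol => s qs; have [_ ->] := qs i k.
Qed.

Lemma mlogit_derivable i k : derivable (fun t => q t i k) th v.
Proof. by apply/derivable1P; apply: ex_derive. Qed.

Let dsol i k : 'D_v (fun t => q t i k) th = 'D_1 (fun s : R => sol i s k 0) 0.
Proof. by rewrite derive_lineE; exact: derive_val. Qed.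

Lemma mlogit_derive_sum i : \sum_k 'D_v (fun t => q t i k) th = 0.
Proof.
rewrite (eq_bigr _ (fun k _ => dsol i k)).
have sd k : is_derive (0 : R) 1 (fun s : R => sol i s k 0)
    ('D_1 (fun s : R => sol i s k 0) 0).
  exact: derivableP.
have [_ <-] := is_derive_big_sum (index_enum _) sd.
rewrite (_ : (fun s : R => \sum_k sol i s k 0) = cst 1) ?derive_cst //.
apply/funext => s.
by have /logit_mx_eqP[] : logit_mx lt (cf i (s *: v + th)) *m sol i s =
  1 *: delta_mx 0 0 by apply/solP.
Qed.

(** Product rule for num = exp(eta) den. Only the last term, which carries [predictor i j v], makes
    this system for the derivatives inhomogeneous. *)
Lemma mlogit_derive_logit i (j : 'I_n) :
  \sum_(k in logit_num lt (J := n.+1) j) 'D_v (fun t => q t i k) th =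
  expR (predictor i j th) *
    \sum_(k in logit_den lt (J := n.+1) j) 'D_v (fun t => q t i k) th +
  (\sum_(k in logit_den lt (J := n.+1) j) q th i k) *
     (predictor i j v * expR (predictor i j th)).
Proof.
have sd k : is_derive (0 : R) 1 (fun s : R => sol i s k 0)
    ('D_1 (fun s : R => sol i s k 0) 0).
  exact: derivableP.
(* Summing over the list [enum B] gives the unfiltered form of sum that [is_derive_big_sum]
   covers. *)
pose part (B : {set 'I_n.+1}) s := \sum_(k <- enum B) sol i s k 0.
have dpart (B : {set 'I_n.+1}) : is_derive (0 : R) 1 (part B)
    (\sum_(k <- enum B) 'D_1 (fun s : R => sol i s k 0) 0).
  exact: is_derive_big_sum.
have [_ dnum] := dpart (logit_num lt (J := n.+1) j).
have [_ dprod] := is_deriveM (@cf_derive i j) (dpart (logit_den lt (J := n.+1) j)).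
have partE : part (logit_num lt (J := n.+1) j) =
    (fun s => cf i (s *: v + th) j) * part (logit_den lt (J := n.+1) j).
  apply/funext => s.
  have /logit_mx_eqP[_ /(_ j)] : logit_mx lt (cf i (s *: v + th)) *m sol i s =
    1 *: delta_mx 0 0 by apply/solP.
  by rewrite mulrfctE /part !big_enum.
move: dnum; rewrite partE dprod /part !big_enum /= scale0r add0r => dE.
rewrite (eq_bigr _ (fun k _ => dsol i k)) -dE; congr (_ + _).
  by congr (_ * _); apply: eq_bigr => k _; rewrite dsol.
congr (_ * _); apply: eq_bigr => k _; exact/esym/q_sol0.
Qed.

End Curve.

(** * The score *)

Lemma ln_big_prod (R : realType) (I : Type) (r : seq I) (f : I -> R) :
  (forall i, 0 < f i) -> ln (\prod_(i <- r) f i) = \sum_(i <- r) ln (f i).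
Proof.
move=> f0; elim: r => [|i r IH]; first by rewrite !big_nil ln1.
by rewrite !big_cons lnM ?posrE ?prodr_gt0 // IH.
Qed.

Section Score.
Variables (R : realType) (m J r : nat) (n : 'I_m -> nat).
Variable q : 'cV[R]_r -> 'I_m -> 'I_J -> R.

Definition compatible (y : 'I_m -> 'I_J -> nat) :=
  [forall i, \sum_k y i k == n i]%N.

Lemma multinomial_pmf_gt0 N (p : 'I_J -> R) (y : 'I_J -> nat) :
  (forall k, 0 < p k) -> (\sum_k y k = N)%N -> 0 < multinomial_pmf N p y.
Proof.
move=> p0 yN; rewrite /multinomial_pmf yN eqxx mulr_gt0 //; last first.
  by apply: prodr_gt0 => k _; rewrite exprn_gt0.
by rewrite divr_gt0 ?ltr0n ?fact_gt0 ?prodr_gt0 // => k _;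
  rewrite ltr0n fact_gt0.
Qed.

Variables (th v : 'cV[R]_r).

(** One factor of the likelihood is 0 for every parameter, so [loglik] is the constant [ln 0]. *)
Lemma derive_loglik_incompatible (y : 'I_m -> 'I_J -> nat) :
  ~~ compatible y -> 'D_v (loglik n q y) th = 0.
Proof.
rewrite negb_forall => /existsP[i yi].
rewrite (_ : loglik n q y = cst (ln 0)) ?derive_cst //.
apply/funext => t; rewrite /loglik /= (bigD1 i) //=.
by rewrite {1}/multinomial_pmf (negbTE yi) mul0r.
Qed.

Hypothesis q_gt0 : \forall s \near (0 : R), forall i k,
  0 < q (s *: v + th) i k.
Hypothesis q_derivable : forall i k, derivable (fun t => q t i k) th v.

(** Positivity near [th] on the line lets the logarithm of the product split; the multinomial
    coefficients, kept in [cst_part], differentiate to 0. *)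
Lemma derive_loglik (y : 'I_m -> 'I_J -> nat) : compatible y ->
  'D_v (loglik n q y) th =
  \sum_i \sum_k (y i k)%:R * ('D_v (fun t => q t i k) th / q th i k).
Proof.
move=> /forallP yn; rewrite derive_lineE.
pose cst_part i := ln ((n i)`!%:R / (\prod_k (y i k)`!%:R)) : R.
have q0 i k : 0 < q th i k.
  by have /(_ i k) := nbhs_singleton q_gt0; rewrite scale0r add0r.
have dq i k : is_derive (0 : R) 1 (fun s : R => q (s *: v + th) i k)
    ('D_v (fun t => q t i k) th).
  have /derivable1P dqk := @q_derivable i k.
  by rewrite derive_lineE; exact: derivableP.
have dlog : is_derive (0 : R) 1
    (fun s => \sum_i (cst_part i + \sum_k (y i k)%:R * ln (q (s *: v + th) i k)))
    (\sum_i \sum_k (y i k)%:R * ('D_v (fun t => q t i k) th / q th i k)).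
  apply: is_derive_big_sum => i.
  rewrite -[X in is_derive _ _ _ X]add0r; apply: is_deriveD.
  apply: is_derive_big_sum => k.
  have q0' : 0 < q (0 *: v + th) i k by rewrite scale0r add0r.
  have := is_derive1_comp (is_derive1_ln q0') (dq i k).
  move=> /(is_deriveZ ((y i k)%:R)); rewrite scale0r add0r mulrC; exact.
rewrite -[RHS](@derive_val _ _ _ _ _ _ _ dlog); apply: near_eq_derive.
apply: filterS q_gt0 => s qs; rewrite /loglik ln_big_prod; last first.
  by move=> i; apply: multinomial_pmf_gt0 => //; exact/eqP.
apply: eq_bigr => i _; rewrite /multinomial_pmf yn lnM ?posrE; last first.
- by apply: prodr_gt0 => k _; rewrite exprn_gt0.
- by rewrite divr_gt0 ?ltr0n ?fact_gt0 ?prodr_gt0 // => k _;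
  rewrite ltr0n fact_gt0.
rewrite ln_big_prod; last by move=> k; rewrite exprn_gt0.
congr (_ + _); apply: eq_bigr => k _.
by rewrite lnXn // mulr_natl.
Qed.

End Score.

(** * Covariance matrices of finitely valued random vectors *)

Section FiniteValued.
Variables (R : realType) (d : measure_display) (T : measurableType d).
Variables (P : probability T R) (I : finType) (Z : T -> I).
Hypothesis mZ : forall z, measurable (Z @^-1` [set z]).

Definition mass z : R := fine (P (Z @^-1` [set z])).

Lemma mass_ge0 z : 0 <= mass z. Proof. exact/fine_ge0/measure_ge0. Qed.

Lemma massE z : P (Z @^-1` [set z]) = (mass z)%:E.
Proof. by rewrite fineK // fin_num_measure. Qed.

(** The integrand is a finite combination of indicators of the fibres of [Z]. *)
Lemma expectation_finite (g : I -> R) :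
  ('E_P[fun w => g (Z w)])%E = (\sum_z g z * mass z)%:E.
Proof.
rewrite unlock.
have -> : (fun w => (g (Z w))%:E) =
    (fun w => \sum_(z <- index_enum I) ((g z)%:E * (\1_(Z @^-1` [set z]) w)%:E)%E)%E.
  apply/funext => w; rewrite (bigD1 (Z w)) //= big1 ?adde0.
    by rewrite indicE mem_set //= mule1.
  move=> z /eqP zw; rewrite indicE memNset ?mule0 //= => zE.
  by apply: zw; rewrite zE.
have ind z : P.-integrable [set: T] (fun w => (\1_(Z @^-1` [set z]) w)%:E).
  exact: integrable_indic.
rewrite integral_sum // => [|z]; last exact: integrableZl.
rewrite -sumEFin; apply: eq_bigr => z _.
by rewrite integralZl // integral_indic // setIT EFinM -massE.
Qed.

Lemma sum_mass : \sum_z mass z = 1.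
Proof.
have := expectation_finite (fun=> 1); rewrite expectation_cst => -[->].
by apply: eq_bigr => z _; rewrite mul1r.
Qed.

Definition mean (f : I -> R) := \sum_z f z * mass z.

Lemma covariance_finite (f g : I -> R) :
  covariance P (fun w => f (Z w)) (fun w => g (Z w)) =
  (\sum_z (f z - mean f) * (g z - mean g) * mass z)%:E.
Proof.
rewrite covariance.unlock !expectation_finite /=.
exact: (expectation_finite (fun z => (f z - mean f) * (g z - mean g))).
Qed.

Variables (r : nat) (s : I -> 'cV[R]_r).

Definition covmx : 'M[R]_r := \matrix_(a, b)
  fine (covariance P (fun w => s (Z w) a 0) (fun w => s (Z w) b 0)).

(** The right-hand side is the variance of the scalar [v^T s]; expanding its square gives the double
    sum of the quadratic form. *)
Lemma covmx_quadratic (v : 'cV[R]_r) : (v^T *m covmx *m v) 0 0 =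
  \sum_z (\sum_a v a 0 * s z a 0 - mean (fun z => \sum_a v a 0 * s z a 0)) ^+ 2
         * mass z.
Proof.
have meanE : mean (fun z => \sum_a v a 0 * s z a 0) =
    \sum_a v a 0 * mean (fun z => s z a 0).
  rewrite /mean; under eq_bigr do rewrite mulr_suml.
  rewrite exchange_big /=; apply: eq_bigr => a _; rewrite mulr_sumr.
  by apply: eq_bigr => z _; rewrite mulrA.
have cE z : \sum_a v a 0 * s z a 0 - mean (fun z => \sum_a v a 0 * s z a 0) =
    \sum_a v a 0 * (s z a 0 - mean (fun z => s z a 0)).
  by rewrite meanE -sumrB; apply: eq_bigr => a _; rewrite mulrBr.
under [RHS]eq_bigr do rewrite cE expr2 big_distrlr /= mulr_suml.
rewrite [LHS]mxE; under [LHS]eq_bigr do rewrite mxE mulr_suml.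
rewrite [LHS]exchange_big [RHS]exchange_big /=; apply: eq_bigr => a _.
under [RHS]eq_bigr do rewrite mulr_suml.
rewrite [RHS]exchange_big /=; apply: eq_bigr => b _.
rewrite !mxE (covariance_finite (fun z => s z a 0) (fun z => s z b 0)) /=.
rewrite mulr_sumr mulr_suml.
by apply: eq_bigr => z _; ring.
Qed.

(** A variance is a sum of nonnegative terms, so it vanishes exactly when [v^T s] equals its mean at
    every atom of positive mass. *)
Lemma covmx_posdefP : posdefmx covmx <->
  forall (v : 'cV[R]_r) c,
    (forall z, 0 < mass z -> \sum_a v a 0 * s z a 0 = c) -> v = 0.
Proof.
split=> [[_ pos] v c vc|inj].
  apply/eqP/negPn/negP => /pos; rewrite covmx_quadratic big1 ?ltxx // => z _.
  have := mass_ge0 z; rewrite le_eqVlt => /orP[/eqP <-|z0].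
    by rewrite mulr0.
  (* The masses add up to 1 and null atoms contribute nothing to the mean. *)
  have -> : mean (fun z => \sum_a v a 0 * s z a 0) = c.
    rewrite -[RHS]mulr1 -sum_mass mulr_sumr; apply: eq_bigr => y _.
    have := mass_ge0 y; rewrite le_eqVlt => /orP[/eqP <-|y0].
      by rewrite !mulr0.
    by rewrite vc.
  by rewrite vc // subrr expr0n mul0r.
split=> [|v v0].
  apply/is_hermitianmxP; rewrite expr0 scale1r; apply/matrixP => a b.
  by rewrite !mxE covarianceC.
have nonneg z : 0 <= (\sum_a v a 0 * s z a 0
    - mean (fun z => \sum_a v a 0 * s z a 0)) ^+ 2 * mass z.
  by rewrite mulr_ge0 ?sqr_ge0 ?mass_ge0.
rewrite covmx_quadratic lt_neqAle sumr_ge0 // andbT eq_sym.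
rewrite psumr_eq0 //; apply: contra v0 => /allP all0; apply/eqP.
apply: (inj _ (mean (fun z => \sum_a v a 0 * s z a 0))) => z z0.
have /implyP/(_ isT) := all0 z (mem_index_enum z).
by rewrite mulf_eq0 sqrf_eq0 (gt_eqF z0) orbF subr_eq0 => /eqP.
Qed.

End FiniteValued.

(** * Rank conditions *)

Section Rank.
Variables (F : fieldType) (m N pc : nat) (p : 'I_N -> nat).
Variables (H : forall j, 'M[F]_(p j, m)) (Hc : 'M[F]_(pc, m)).

Definition kernel_trivial :=
  forall (b : forall j, 'rV[F]_(p j)) (z : 'rV[F]_pc),
    (forall j, b j *m H j + z *m Hc = 0) -> (forall j, b j = 0) /\ z = 0.

(** If all equations hold, [z *m Hc] equals each [- b j *m H j], hence lies in the intersection and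
    is 0; full ranks then give [b] and [z] zero. Conversely, a rank defect or a nonzero common
    vector yields a nonzero kernel element. *)
Lemma kernel_trivialP : (0 < N)%N -> kernel_trivial <->
  [/\ forall j, \rank (H j) = p j, \rank Hc = pc
    & (<<Hc>> :&: \bigcap_(j < N) <<H j>>)%MS = 0].
Proof.
move=> N0; split=> [K|[rH rHc I0] b z bz].
  split.
  - move=> j0; apply/eqP/inj_row_free => v vH.
    (* The family equal to [v] at [j0] and 0 elsewhere; the cast is there because the type of [b j]
       depends on [j]. *)
    pose b j : 'rV[F]_(p j) := 
      if j0 =P j is ReflectT e then castmx (erefl, congr1 p e) v else 0.
    have [] := K b 0.
      move=> j; rewrite mul0mx addr0 /b; case: eqP => [e|]; last by rewrite mul0mx.
      by case: j / e => /=; rewrite castmx_id.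
    by move=> /(_ j0); rewrite /b; case: eqP => // e; rewrite castmx_id.
  - apply/eqP/inj_row_free => z zH.
    by have [] := K (fun=> 0) z => // j; rewrite mul0mx add0r.
  - apply/eqP; rewrite -submx0; apply/rV_subP => u.
    rewrite sub_capmx genmxE => /andP[/submxP[z uz] /sub_bigcapmxP uH].
    have /all_sig[b ub] j : {b | u = b *m H j}.
      have : (u <= H j)%MS by rewrite -(genmxE (H j)) uH.
      by move/submxP/cid.
    have [] := K (fun j => - b j) z.
      by move=> j; rewrite mulNmx -ub -uz addNr.
    by move=> _ z0; rewrite uz z0 mul0mx sub0mx.
have free_eq0 k (A : 'M[F]_(k, m)) (v : 'rV[F]_k) :
  \rank A = k -> v *m A = 0 -> v = 0.
  move=> rA vA; apply: (row_free_inj (A := A)); first exact/eqP.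
  by rewrite mul0mx.
have zHc : z *m Hc = 0.
  apply/eqP; rewrite -submx0 -[X in (_ <= X)%MS]I0 sub_capmx genmxE submxMl /=.
  apply/sub_bigcapmxP => j _; rewrite genmxE.
  have /eqP := bz j; rewrite addrC addr_eq0 => /eqP ->.
  by rewrite -mulNmx submxMl.
split=> [j|]; last exact: free_eq0 zHc.
by apply: free_eq0 (rH j) _; have := bz j; rewrite zHc addr0.
Qed.

(** With trivial intersection the dimensions [pc] and [pH] add up inside a space of dimension
    [m]. *)
Lemma rank_conditions_bound :
  (forall j, \rank (H j) = p j) -> \rank Hc = pc ->
  (<<Hc>> :&: \bigcap_(j < N) <<H j>>)%MS = 0 ->
  (maxn (\max_(j < N) p j) (pc + \rank (\bigcap_(j < N) <<H j>>)%MS) <= m)%N.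
Proof.
move=> rH rHc I0; rewrite geq_max; apply/andP; split.
  by apply/bigmax_leqP => j _; rewrite -rH rank_leq_col.
rewrite -[X in (X + _)%N]rHc -(mxrank_gen Hc) -mxrank_sum_cap I0 mxrank0 addn0.
exact: rank_leq_col.
Qed.

(** The intersection is now the row space of [H j1]. By the dimension formula the stacked matrix has
    full rank iff both blocks do and their row spaces meet in 0. *)
Lemma rank_conditions_common (j1 : 'I_N) :
  (forall j, exists e : p j = p j1, castmx (e, erefl m) (H j) = H j1) ->
  [/\ forall j, \rank (H j) = p j, \rank Hc = pc
    & (<<Hc>> :&: \bigcap_(j < N) <<H j>>)%MS = 0] <->
  \rank (row_mx (H j1)^T Hc^T) = (pc + p j1)%N.
Proof.
move=> Heq.
have HE j : (H j :=: H j1)%MS.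
  have [e <-] := Heq j; exact/eqmx_sym/eqmx_cast.
have capE : (\bigcap_(j < N) <<H j>> :=: H j1)%MS.
  apply/eqmxP/andP; split.
    by rewrite -(genmxE (H j1)); apply: bigcapmx_inf (submx_refl _).
  by apply/sub_bigcapmxP => j _; rewrite genmxE (HE j) submx_refl.
rewrite -tr_col_mx mxrank_tr -addsmxE.
have sum_cap := mxrank_sum_cap (H j1) Hc.
have capC : \rank (<<Hc>> :&: \bigcap_(j < N) <<H j>>)%MS = \rank (H j1 :&: Hc)%MS.
  by rewrite capmxC (cap_eqmx capE (genmxE Hc)).
have rj := rank_leq_row (H j1); have rc := rank_leq_row Hc.
split=> [[rH rHc I0]|rS].
  by move: capC sum_cap; rewrite I0 mxrank0 rH rHc; lia.
split.
- move=> j; have [e _] := Heq j.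
  by rewrite (HE j) e; lia.
- lia.
- by apply/eqP; rewrite -mxrank_eq0 capC; lia.
Qed.

End Rank.

(** * Positive definiteness of the Fisher information *)

Section Truncation.
Variables (m J : nat) (n : 'I_m -> nat).

Let bound := \max_i n i.

(** The cap [bound.+1] exceeds every [n i]: compatible tables are unchanged, and a table with a
    capped entry remains incompatible. *)
Definition trunc_counts (y : 'I_m -> 'I_J -> nat) :
  {ffun 'I_m * 'I_J -> 'I_bound.+2} :=
  [ffun ik => inord (minn (y ik.1 ik.2) bound.+1)].

Definition counts_of b (z : {ffun 'I_m * 'I_J -> 'I_b}) :
  'I_m -> 'I_J -> nat := fun i k => z (i, k).

Lemma compatible_le (y : 'I_m -> 'I_J -> nat) i k :
  compatible n y -> (y i k <= bound)%N.
Proof.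
move=> /forallP/(_ i)/eqP yn; apply: leq_trans (leq_bigmax i).
by rewrite -yn (bigD1 k) //= leq_addr.
Qed.

Lemma counts_of_trunc (y : 'I_m -> 'I_J -> nat) i k :
  counts_of (trunc_counts y) i k = minn (y i k) bound.+1.
Proof. by rewrite /counts_of ffunE /= inordK // ltnS geq_minr. Qed.

Lemma trunc_countsK (y : 'I_m -> 'I_J -> nat) :
  compatible n (counts_of (trunc_counts y)) || compatible n y ->
  counts_of (trunc_counts y) = y.
Proof.
move=> yc; apply/funext => i; apply/funext => k; rewrite counts_of_trunc.
apply/minn_idPl; case/orP: yc => yc; last exact/ltnW/compatible_le.
by have := compatible_le i k yc; rewrite counts_of_trunc; lia.
Qed.

Lemma counts_ofK (y : 'I_m -> 'I_J -> nat) z : compatible n (counts_of z) ->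
  trunc_counts y = z <-> y = counts_of z.
Proof.
move=> zc; split=> [yz|->]; first by rewrite -yz trunc_countsK // yz zc.
apply/ffunP => -[i k]; apply/val_inj.
rewrite /= ffunE /= inordK ?ltnS ?geq_minr //.
by apply/minn_idPl; rewrite -ltnS ltn_ord.
Qed.

End Truncation.

(** Built from partial derivatives, as the score is, so that linearity in [v] holds by construction,
    which is not immediate for ['D_v]. *)
Definition grad_dot (R : realType) (m J r : nat)
    (q : 'cV[R]_r -> 'I_m -> 'I_J -> R) (th v : 'cV[R]_r) i k : R :=
  \sum_a v a 0 * 'D_(delta_mx a 0) (fun t => q t i k) th.

Section FisherInformation.
Variables (R : realType) (m J r : nat) (n : 'I_m -> nat).
Variable q : 'cV[R]_r -> 'I_m -> 'I_J -> R.
Variables (th : 'cV[R]_r).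
Variables (d : measure_display) (T : measurableType d) (P : probability T R).
Variable Y : 'I_m -> T -> 'I_J -> nat.
Hypothesis mY : forall i k (A : set nat), measurable ((fun w => Y i w k) @^-1` A).

Let Z w := trunc_counts n (fun i => Y i w).
Let s (z : {ffun 'I_m * 'I_J -> 'I_(\max_i n i).+2}) := score n q th (counts_of z).

(** The score factors through truncation: compatible tables are fixed by it, and on incompatible
    ones both scores are 0. *)
Lemma fisher_covmx : fisher n q P Y th = covmx P Z s.
Proof.
have scoreE w : score n q th (fun i => Y i w) = s (Z w).
  have [yc|yc] := boolP
    (compatible n (counts_of (Z w)) || compatible n (fun i => Y i w)).
    by rewrite /s /Z trunc_countsK.
  move: yc; rewrite negb_or => /andP[zc yc].
  by apply/colP => a; rewrite !mxE !derive_loglik_incompatible.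
apply/matrixP => a b; rewrite !mxE; congr (fine (covariance P _ _));
  by apply/funext => w; rewrite scoreE.
Qed.

Lemma measurable_trunc z : measurable (Z @^-1` [set z]).
Proof.
rewrite (_ : _ @^-1` _ = \bigcap_(ik in [set: 'I_m * 'I_J])
   ((fun w => Y ik.1 w ik.2) @^-1`
     [set c | inord (minn c (\max_i n i).+1) = z ik])).
  by apply: fin_bigcap_measurable => // ik _; exact: mY.
apply/seteqP; split=> w /= => [<- ik _|wz]; first by rewrite /= ffunE.
by apply/ffunP => ik; rewrite ffunE; exact: wz.
Qed.

Hypothesis q_gt0 : forall i k, 0 < q th i k.
Hypothesis Y_law : forall i, multinomial_law P (Y i) (n i) (q th i).
Hypothesis Y_indep : independent_counts P Y.

(** By independence this mass is a product of positive multinomial probabilities. *)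
Lemma mass_compatible_gt0 z : compatible n (counts_of z) -> 0 < mass P Z z.
Proof.
move=> zc; rewrite -lte_fin -massE; last exact: measurable_trunc.
rewrite (_ : _ @^-1` _ = \bigcap_(i in [set: 'I_m]) (Y i @^-1` [set counts_of z i])).
  rewrite Y_indep; apply: (big_ind (fun e => 0 < e)%E) => //.
    by move=> a b a0 b0; rewrite mule_gt0.
  move=> i _; rewrite Y_law lte_fin multinomial_pmf_gt0 //.
  by apply/eqP; move/forallP: zc.
apply/seteqP; split=> w /=.
  by move=> /(counts_ofK _ zc) yz i _; rewrite -yz.
by move=> wz; apply/counts_ofK => //; apply/funext => i; exact: wz.
Qed.

Hypothesis n_gt0 : forall i, (0 < n i)%N.
Hypothesis q_line_gt0 : forall v, \forall t \near (0 : R), forall i k,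
  0 < q (t *: v + th) i k.
Hypothesis q_derivable : forall v i k, derivable (fun t => q t i k) th v.

Let dq := grad_dot q th.

Let score_dir (v : 'cV[R]_r) z : \sum_a v a 0 * s z a 0 =
  if compatible n (counts_of z)
  then \sum_i \sum_k (counts_of z i k)%:R * (dq v i k / q th i k) else 0.
Proof.
case: ifPn => zc; last first.
  by rewrite big1 // => a _; rewrite mxE derive_loglik_incompatible ?mulr0.
have sE a : v a 0 * s z a 0 = \sum_i \sum_k v a 0 * ((counts_of z i k)%:R *
    ('D_(delta_mx a 0) (fun t => q t i k) th / q th i k)).
  rewrite mxE derive_loglik // mulr_sumr.
  by apply: eq_bigr => i _; rewrite mulr_sumr.
rewrite (eq_bigr _ (fun a _ => sE a)) exchange_big; apply: eq_bigr => i _ /=.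
rewrite exchange_big; apply: eq_bigr => k _ /=.
rewrite /dq /grad_dot mulr_suml mulr_sumr; apply: eq_bigr => a _; ring.
Qed.

Hypothesis dq_sum : forall v i, \sum_k grad_dot q th v i k = 0.
Hypothesis q_sum : forall i, \sum_k q th i k = 1.

(* Putting all n_i observations of setting i in one category k_i has positive
   probability for every choice of the k_i; comparing the score for these
   outcomes shows that dq_ik / q_ik does not depend on k, and it averages to 0. *)
Lemma fisher_posdefP : posdefmx (fisher n q P Y th) <->
  forall v : 'cV[R]_r, (forall i k, grad_dot q th v i k = 0) -> v = 0.
Proof.
rewrite fisher_covmx (covmx_posdefP P measurable_trunc s).
split=> [inj v v0|inj v c vc].
  apply: (inj v 0) => z _; rewrite score_dir; case: ifP => // _.
  by rewrite big1 // => i _; rewrite big1 // => k _; rewrite /dq v0 mul0r mulr0.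
apply: inj => i0 k0.
pose w i k := dq v i k / q th i k.
pose point (f : 'I_m -> 'I_J) i k := if k == f i then n i else 0%N.
have point_c f : compatible n (point f).
  by apply/forallP => i; rewrite /point -big_mkcond big_pred1_eq.
have pointE f : \sum_i (n i)%:R * w i (f i) = c.
  have fK : counts_of (trunc_counts n (point f)) = point f.
    by rewrite trunc_countsK // point_c orbT.
  rewrite -(vc (trunc_counts n (point f))); last first.
    by apply: mass_compatible_gt0; rewrite fK.
  rewrite score_dir fK point_c; apply: eq_bigr => i _.
  rewrite (bigD1 (f i)) //= big1 ?addr0 /point ?eqxx // => k /negbTE ->.
  by rewrite mul0r.
have wE k : w i0 k = w i0 k0.
  have := pointE (fun i => if i == i0 then k else k0).
  rewrite -(pointE (fun=> k0)) (bigD1 i0) //= [RHS](bigD1 i0) //= eqxx.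
  rewrite [X in _ + X = _](eq_bigr (fun i => (n i)%:R * w i k0)); last first.
    by move=> i /negbTE ->.
  move/addIr/mulfI; apply; rewrite pnatr_eq0 -lt0n; exact: n_gt0.
have w0 : w i0 k0 = 0.
  have := dq_sum v i0.
  rewrite (eq_bigr (fun k => w i0 k0 * q th i0 k)).
    by rewrite -mulr_sumr q_sum mulr1.
  by move=> k _; rewrite -(wE k) /w divfK // gt_eqF.
by move/eqP: w0; rewrite /w mulf_eq0 invr_eq0 (gt_eqF (q_gt0 _ _)) orbF => /eqP.
Qed.

End FisherInformation.

(** * Identifiability of the linear predictors *)

Section Identifiability.
Variables (R : realType) (d m n pc : nat) (p : 'I_n -> nat).
Variables (lt : logit_type) (x : 'I_m -> 'cV[R]_d).
Variables (h : forall j : 'I_n, 'cV[R]_d -> 'cV[R]_(p j)).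
Variable hc : 'cV[R]_d -> 'cV[R]_pc.

Lemma predictor_coord i j (v : 'cV[R]_(\sum_j p j + pc)) :
  predictor x h hc i j v = \sum_a v a 0 * predictor x h hc i j (delta_mx a 0).
Proof.
have p0 : predictor x h hc i j 0 = 0.
  (* With [t = -1] the two predictors at 0 cancel. *)
  by have := predictorP x h hc i j (-1) 0 0; rewrite scaler0 addr0 mulN1r addNr.
rewrite {1}(matrix_sum_delta v) (eq_bigr (fun a => v a 0 *: delta_mx a 0)).
  elim/big_rec2: _ => // a y z _ <-.
  by rewrite predictorP.
by move=> a _; rewrite big_ord1.
Qed.

Lemma predictor_row j (v : 'cV[R]_(\sum_j p j + pc)) :
  (beta (J := n.+1) v j)^T *m Hmx (J := n.+1) x h j
    + (zeta (J := n.+1) v)^T *m Hcmx x hc =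
  \row_i predictor x h hc i j v.
Proof.
apply/rowP => i; rewrite !mxE /predictor !mxE.
by congr (_ + _); apply: eq_bigr => k _; rewrite !mxE mulrC.
Qed.

Lemma predictor_kernelP :
  (forall v, (forall i j, predictor x h hc i j v = 0) -> v = 0) <->
  kernel_trivial (fun j : 'I_n => Hmx (J := n.+1) x h j) (Hcmx x hc).
Proof.
split=> [inj b z bz|K v v0].
  pose v : 'cV[R]_(\sum_j p j + pc) := col_mx (\mxcol_j (b j)^T) z^T.
  have bv j : beta (J := n.+1) v j = (b j)^T.
    by rewrite /beta col_mxKu mxcolK.
  have zv : zeta (J := n.+1) v = z^T by rewrite /zeta col_mxKd.
  have v0 : v = 0.
    apply: inj => i j; have := predictor_row j v.
    by rewrite bv zv !trmxK bz => /rowP/(_ i); rewrite !mxE.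
  split=> [j|]; apply: trmx_inj; rewrite trmx0.
    by rewrite -bv v0; apply/colP => k; rewrite !mxE.
  by rewrite -zv v0; apply/colP => k; rewrite !mxE.
have [j|b0 z0] := K (fun j => (beta (J := n.+1) v j)^T) (zeta (J := n.+1) v)^T.
  by rewrite predictor_row; apply/rowP => i; rewrite !mxE v0.
have beta0 j : beta (J := n.+1) v j = 0 by apply: trmx_inj; rewrite b0 trmx0.
rewrite -(vsubmxK v) [dsubmx v](trmx_inj (etrans z0 (esym (trmx0 _ _ _)))).
rewrite -(submxcolK (usubmx v)) -[RHS]col_mx0; congr col_mx.
by apply/colP => k; rewrite mxE [submxcol _ _](beta0 _) !mxE.
Qed.

Variable q : 'cV[R]_(\sum_j p j + pc) -> 'I_m -> 'I_n.+1 -> R.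
Hypothesis q_model : forall t, mlogit_dom (J := n.+1) lt x h hc t ->
  mlogit_model (J := n.+1) lt x h hc t (q t).
Variable th : 'cV[R]_(\sum_j p j + pc).
Hypothesis th_dom : mlogit_dom (J := n.+1) lt x h hc th.

Lemma grad_dot_sum v i : \sum_k grad_dot q th v i k = 0.
Proof.
rewrite exchange_big big1 // => a _.
by rewrite -mulr_sumr (mlogit_derive_sum q_model) ?mulr0.
Qed.

(** Both sides are linear in [v], so the coordinate cases of [mlogit_derive_logit] add up. *)
Lemma grad_dot_logit v i (j : 'I_n) :
  \sum_(k in logit_num lt (J := n.+1) j) grad_dot q th v i k =
  expR (predictor x h hc i j th) *
    \sum_(k in logit_den lt (J := n.+1) j) grad_dot q th v i k +
  (\sum_(k in logit_den lt (J := n.+1) j) q th i k) *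
     (predictor x h hc i j v * expR (predictor x h hc i j th)).
Proof.
rewrite (predictor_coord i j v) exchange_big [X in _ * X + _]exchange_big /=.
rewrite [X in _ + _ * X]mulr_suml [X in _ = X + _]mulr_sumr.
rewrite [X in _ = _ + X]mulr_sumr -big_split; apply: eq_bigr => a _ /=.
rewrite -!mulr_sumr (mlogit_derive_logit q_model) //; ring.
Qed.

(** If the derivatives vanish, the inhomogeneous term must vanish, and its factors other than the
    predictor are positive. If the predictors vanish, the derivatives solve the homogeneous system,
    which is injective. *)
Lemma grad_dot_eq0 v : (forall i k, grad_dot q th v i k = 0) <->
  (forall i j, predictor x h hc i j v = 0).
Proof.
have /mlogit_modelP[q0 _] := q_model th_dom.
split=> [g0 i j|p0 i].
  have := grad_dot_logit v i j; rewrite big1 // [X in _ * X + _]big1 //.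
  rewrite mulr0 add0r => /esym/eqP; rewrite !mulf_eq0 orbC.
  rewrite (gt_eqF (expR_gt0 _)) orbF => /orP[/eqP //|].
  have [_ [k kB]] := logit_num_den_neq0 lt j.
  rewrite gt_eqF // (bigD1 k) //= ltr_pwDl // sumr_ge0 // => l _; exact: ltW.
apply: (logit_system_inj (lt := lt) (c := fun j => expR (predictor x h hc i j th))).
- by move=> j; exact: expR_gt0.
- by move=> j; rewrite grad_dot_logit p0 mul0r mulr0 addr0.
- exact: grad_dot_sum.
Qed.

End Identifiability.

Unset Implicit Arguments.

Theorem theorem3p3 (R : realType) (d m J pc : nat) (p : 'I_J.-1 -> nat)
    (lt : logit_type) (x : 'I_m -> 'cV[R]_d)
    (h : forall j : 'I_J.-1, 'cV[R]_d -> 'cV[R]_(p j))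
    (hc : 'cV[R]_d -> 'cV[R]_pc)
    (n : 'I_m -> nat)
    (q : 'cV[R]_(\sum_j p j + pc) -> 'I_m -> 'I_J -> R)
    (theta : 'cV[R]_(\sum_j p j + pc))
    (disp : measure_display) (T : measurableType disp) (P : probability T R)
    (Y : 'I_m -> 'I_J -> {RV P >-> nat}) :
  (1 <= d)%N -> (2 <= m)%N -> (2 <= J)%N ->
  (forall j, 1 <= p j)%N ->
  injective x ->
  (forall i, 0 < n i)%N ->
  (forall t, mlogit_dom lt x h hc t -> mlogit_model lt x h hc t (q t)) ->
  mlogit_dom lt x h hc theta ->
  (forall i, multinomial_law P (fun w k => Y i k w) (n i) (q theta i)) ->
  independent_counts P (fun i w k => Y i k w) ->
  let F := fisher n q P (fun i w k => Y i k w) theta in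
  let H := Hmx x h in
  let Hc := Hcmx x hc in
  let pH := \rank (\bigcap_(j < J.-1) colspace (H j)^T)%MS in
  (posdefmx F <->
     (maxn (\max_(j < J.-1) p j) (pc + pH) <= m)%N /\
     [/\ forall j, \rank (H j) = p j,
         \rank Hc = pc
       & (colspace Hc^T :&: \bigcap_(j < J.-1) colspace (H j)^T)%MS = 0])
  /\
  (forall j1 : 'I_J.-1, j1 = 0%N :> nat ->
     (forall j, exists e : p j = p j1,
        castmx (e, erefl m) (H j) = H j1) ->
     (posdefmx F <->
        (pc + p j1 <= m)%N /\
        \rank (row_mx (H j1)^T Hc^T) = (pc + p j1)%N)).
Proof.
(* From here [J] counts the logits and there are [J.+1] categories, so that the predecessor
   computes. *)
case: J p h q theta Y => [//|J] p h q theta Y _ _ J_gt1 _ _ n_gt0.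
move=> q_model th_dom Y_law Y_indep F H Hc pH.
have mY i k (A : set nat) : measurable ((fun w => Y i k w) @^-1` A).
  by rewrite -[X in measurable X]setTI; exact: (measurable_funPT (Y i k)).
have [q0 q1 _] := q_model _ th_dom.
have posE : posdefmx F <-> kernel_trivial H Hc.
  apply: iff_trans (predictor_kernelP x h hc).
  apply: iff_trans (fisher_posdefP mY q0 Y_law Y_indep n_gt0 _ _ _ q1) _.
  - by move=> v; exact: (mlogit_line_gt0 q_model).
  - by move=> v i k; exact: (mlogit_derivable q_model).
  - by move=> v i; exact: (grad_dot_sum q_model).
  have gE := grad_dot_eq0 q_model th_dom.
  by split=> inj v v0; apply: inj; [exact: (gE v).2|exact: (gE v).1].
have capE : (\bigcap_(j < J) colspace (H j)^T)%MS = (\bigcap_(j < J) <<H j>>)%MS.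
  by apply: eq_bigr => j _; rewrite /colspace trmxK.
have condE : posdefmx F <-> [/\ forall j, \rank (H j) = p j, \rank Hc = pc
    & (<<Hc>> :&: \bigcap_(j < J) <<H j>>)%MS = 0].
  by apply: iff_trans posE _; exact: kernel_trivialP.
have colE : colspace Hc^T = <<Hc>>%MS by rewrite /colspace trmxK.
rewrite /pH capE colE; split.
  split=> [/condE[rH rHc I0]|[_ /condE//]].
  by split=> //; exact: (rank_conditions_bound rH rHc I0).
move=> j1 _ Heq; apply: iff_trans condE _.
apply: iff_trans (rank_conditions_common Hc Heq) _.
split=> [rE|[]//]; split=> //.
(* The extended matrix has [m] rows, which bounds its rank. *)
by rewrite -rE rank_leq_row.
Qed.
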